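(* Let $J\in\mathbb{R}^{m\times n}$ have full column rank, let $H\in\mathbb{R}^{m\times m}$ be symmetric positive definite, $q\in\mathbb{R}^m$, $c\in\mathbb{R}$, and consider minimizing $L(\theta)=\mathcal{L}(J\theta)$ with $\mathcal{L}(v)=\tfrac12 v^\top Hv+v^\top q+c$. Assume strong consistency: (1) there is $\theta^*$ with $J\theta^*=\arg\min_v\mathcal{L}(v)$, and (2) $\mathrm{range}(HJ)\subseteq\mathrm{range}(J)$. Consider SNGD $$\theta_{t+1}=\theta_t-\eta\,J_S^{+(\lambda)}(H_SJ\theta_t+q_S)$$ with batch size $k$ and regularization $\lambda\ge 0$, where at each iteration $S\subseteq\{1,\dots,m\}$, $|S|=k$, is drawn uniformly without replacement, independently across iterations. Let $P(S)=J_S^{+(\lambda)}J_S$, $\overline{P}=\mathbb{E}_S[P(S)]$, $\alpha=\lambda_{\min}(\overline{P})$, and assume $\overline{P}$ is nonsingular and shares an eigenbasis with $J^\top J$. Define the positive definite matrix $\overline{Q}=(J^\top J)^{-1/2}\overline{P}(J^\top J)^{-1/2}$, the matrix $\tilde H=(J^\top J)^{-1/2}J^\top HJ(J^\top J)^{-1/2}$, and $$\gamma=1\Big/\lambda_{\max}\Big(\mathbb{E}_S\big[(J^\top J)^{-1/2}P(S)\overline{Q}^{-1}P(S)(J^\top J)^{-1/2}\big]\Big).$$ Then $\gamma\ge\kappa^{-1}(\overline{Q})$, and with step size $\eta=\gamma/\lambda_{\max}(\tilde H)$ the SNGD iterates satisfy $$\mathbb{E}\,\|\theta_t-\theta^*\|^2_{\overline{Q}^{-1}}\le\big(1-\kappa^{-1}(\tilde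 H)\cdot\alpha\cdot\gamma\big)^t\,\|\theta_0-\theta^*\|^2_{\overline{Q}^{-1}} .$$
   Context: $J_S$, $H_S$ denote rows of $J$, $H$ indexed by $S$; $q_S$ the corresponding entries of $q$. $J_S^{+(\lambda)}=(J_S^\top J_S+\lambda I)^{-1}J_S^\top=J_S^\top(J_SJ_S^\top+\lambda I)^{-1}$ (Moore–Penrose pseudoinverse when $\lambda=0$). $\kappa(A)$ denotes the condition number $\lambda_{\max}(A)/\lambda_{\min}(A)$ of a symmetric positive definite matrix, and $\|x\|_A^2=x^\top Ax$. *)

(* Defs.v *)
From HB Require Import structures.
From mathcomp Require Import all_boot all_order all_algebra.
From mathcomp Require Import boolp classical_sets reals.
Set Implicit Arguments. Unset Strict Implicit. Unset Printing Implicit Defensive.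
Import Order.TTheory GRing.Theory Num.Theory.
Local Open Scope ring_scope.
Local Open Scope classical_set_scope.

Section Defs.
Variable R : realType.

Definition qform n (A : 'M[R]_n) (x : 'cV[R]_n) : R := (x^T *m A *m x) 0 0.

Definition symmetric n (A : 'M[R]_n) := A^T = A.

Definition posdef n (A : 'M[R]_n) :=
  symmetric A /\ forall x : 'cV[R]_n, x != 0 -> 0 < qform A x.

Definition lambda_max n (A : 'M[R]_n) : R := sup [set a | eigenvalue A a].
Definition lambda_min n (A : 'M[R]_n) : R := inf [set a | eigenvalue A a].
Definition cond_number n (A : 'M[R]_n) : R := lambda_max A / lambda_min A.

Definition msqrt n (A : 'M[R]_n) : 'M[R]_n :=
  xget 0 [set B | posdef B /\ B *m B = A].
Definition minvsqrt n (A : 'M[R]_n) : 'M[R]_n := invmx (msqrt A).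

(* Moore-Penrose pseudoinverse: the unique X satisfying the Penrose equations *)
Definition mp_pinv p n (A : 'M[R]_(p, n)) : 'M[R]_(n, p) :=
  xget 0 [set X | [/\ A *m X *m A = A, X *m A *m X = X,
                      (A *m X)^T = A *m X & (X *m A)^T = X *m A]].

Definition reg_pinv p n (lam : R) (A : 'M[R]_(p, n)) : 'M[R]_(n, p) :=
  if lam == 0 then mp_pinv A else invmx (A^T *m A + lam%:M) *m A^T.

Definition rows_of m p (S : {set 'I_m}) (A : 'M[R]_(m, p)) : 'M[R]_(#|S|, p) :=
  rowsub (fun i : 'I_#|S| => enum_val i) A.

Definition ksubsets m k : {set {set 'I_m}} := [set S : {set 'I_m} | #|S| == k].

Definition ES m k p q (F : {set 'I_m} -> 'M[R]_(p, q)) : 'M[R]_(p, q) :=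
  (#|ksubsets m k|%:R)^-1 *: \sum_(S in ksubsets m k) F S.

Definition PS m n (lam : R) (J : 'M[R]_(m, n)) (S : {set 'I_m}) : 'M[R]_n :=
  reg_pinv lam (rows_of S J) *m rows_of S J.

Definition sngd_step m n (lam eta : R) (J : 'M[R]_(m, n)) (H : 'M[R]_m)
    (q : 'cV[R]_m) (S : {set 'I_m}) (th : 'cV[R]_n) : 'cV[R]_n :=
  th - eta *: (reg_pinv lam (rows_of S J) *m (rows_of S H *m J *m th + rows_of S q)).

Definition sngd_iter m n t (lam eta : R) (J : 'M[R]_(m, n)) (H : 'M[R]_m)
    (q : 'cV[R]_m) (th0 : 'cV[R]_n) (s : {ffun 'I_t -> {set 'I_m}}) : 'cV[R]_n :=
  foldl (fun th S => sngd_step lam eta J H q S th) th0 (fgraph s).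

(* expectation over t i.i.d. uniform k-subsets *)
Definition Eiter m k t (F : {ffun 'I_t -> {set 'I_m}} -> R) : R :=
  (#|ksubsets m k|%:R ^+ t)^-1 *
  \sum_(s : {ffun 'I_t -> {set 'I_m}} | [forall i, s i \in ksubsets m k]) F s.

Definition quadL m (H : 'M[R]_m) (q : 'cV[R]_m) (c : R) (v : 'cV[R]_m) : R :=
  2^-1 * qform H v + (v^T *m q) 0 0 + c.

End Defs.

(* Main.v *)
(** Write [B] for the square root of [J^T J], [M] for its inverse, [e] for the error
[theta - theta*] and [u = B e]. First-order optimality together with
range(HJ) in range(J) turns an SNGD step into [e |-> e - eta P(S) W e] with
[W = M Htil B]. As [Pbar] commutes with [B], [Qbar^-1 Pbar W = B Htil B], so the mean of
the squared [Qbar^-1]-norm after one step is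
[|e|^2 - 2 eta u^T Htil u + eta^2 (Htil u)^T N (Htil u)], where [1 / gamma] is the largest
eigenvalue of [N]. Now [N <= 1 / gamma], [Htil^2 <= lambda_max(Htil) Htil],
[Htil >= lambda_min(Htil)] and [Pbar^-1 <= 1 / alpha] give the contraction factor, and
independence iterates it. The bound on [gamma] uses [P(S)^2 <= P(S)] and
[Qbar^-1 <= 1 / lambda_min(Qbar)].

Instead of the spectral theorem, extreme eigenvalues are obtained as extrema of the
Rayleigh quotient, and the square root of [J^T J] from the given shared eigenbasis. *)

Require Import Defs.
From HB Require Import structures.
From mathcomp Require Import all_boot all_order all_algebra.
From mathcomp Require Import boolp classical_sets reals.
From mathcomp Require Import ring lra.
Set Implicit Arguments. Unset Strict Implicit. Unset Printing Implicit Defensive.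
Import Order.TTheory GRing.Theory Num.Theory.
Local Open Scope ring_scope.

(** * Quadratic forms, positive definiteness and coercivity *)

Section QuadraticForms.
Variables (R : realType) (n : nat).
Implicit Types (A B : 'M[R]_n) (x : 'cV[R]_n).

Lemma qformD A B x : qform (A + B) x = qform A x + qform B x.
Proof. by rewrite /qform mulmxDr mulmxDl mxE. Qed.

Lemma qformN A x : qform (- A) x = - qform A x.
Proof. by rewrite /qform mulmxN mulNmx mxE. Qed.

Lemma qformB A B x : qform (A - B) x = qform A x - qform B x.
Proof. by rewrite qformD qformN. Qed.

Lemma qformZ a A x : qform (a *: A) x = a * qform A x.
Proof. by rewrite /qform -scalemxAr -scalemxAl mxE. Qed.

Lemma qform_sum (I : finType) (P : pred I) (F : I -> 'M[R]_n) x :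
  qform (\sum_(i | P i) F i) x = \sum_(i | P i) qform (F i) x.
Proof. by rewrite /qform mulmx_sumr mulmx_suml summxE. Qed.

Lemma qform_scalar a x : qform a%:M x = a * qform 1%:M x.
Proof. by rewrite -[a%:M]scalemx1 qformZ. Qed.

Lemma qform_mul p (A : 'M[R]_p) (C : 'M[R]_(p, n)) x :
  qform A (C *m x) = qform (C^T *m A *m C) x.
Proof. by rewrite /qform trmx_mul !mulmxA. Qed.

Lemma qform1E x : qform 1%:M x = \sum_i x i 0 ^+ 2.
Proof.
rewrite /qform mulmx1 mxE; apply: eq_bigr => i _; by rewrite mxE expr2.
Qed.

Lemma qform1_ge0 x : 0 <= qform 1%:M x.
Proof. by rewrite qform1E sumr_ge0 // => i _; rewrite sqr_ge0. Qed.

Lemma qform1_eq0 x : (qform 1%:M x == 0) = (x == 0).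
Proof.
rewrite qform1E psumr_eq0 => [|i _]; last exact: sqr_ge0.
apply/idP/eqP => [/allP h|->].
  apply/matrixP => i j; rewrite ord1 mxE.
  by apply/eqP; rewrite -sqrf_eq0; exact: (h i (mem_index_enum i)).
by apply/allP => i _; rewrite /= mxE expr0n eqxx.
Qed.

Lemma qform1_gt0 x : x != 0 -> 0 < qform 1%:M x.
Proof. by move=> x0; rewrite lt_neqAle qform1_ge0 eq_sym qform1_eq0 x0. Qed.

Lemma qform0 A : qform A 0 = 0.
Proof. by rewrite /qform mulmx0 mxE. Qed.

(** The constant is the sum of the absolute entries, since [|x i| |x j| <= |x|^2]; the added 1 makes
    it positive, so that it may be divided by. *)
Lemma qform_bounded A : exists2 c, 0 < c & forall x, qform A x <= c * qform 1%:M x.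
Proof.
exists (1 + \sum_i \sum_j `|A i j|).
  by rewrite ltr_pwDl // sumr_ge0 // => i _; rewrite sumr_ge0.
move=> x; rewrite mulrDl mul1r -[leLHS]add0r lerD ?qform1_ge0 //.
rewrite {1}/qform mxE exchange_big /= mulr_suml; apply: ler_sum => i _.
rewrite mxE !mulr_suml; apply: ler_sum => j _; rewrite mxE.
have bnd l : x l 0 ^+ 2 <= qform 1%:M x.
  by rewrite qform1E (bigD1 l) //= lerDl sumr_ge0 // => ? _; rewrite sqr_ge0.
have := ler_norm (x j 0 * A j i * x i 0); move: (bnd i) (bnd j).
rewrite !normrM => hi hj /le_trans; apply.
have h : `|x j 0| * `|x i 0| <= qform 1%:M x.
  have := sqr_ge0 (`|x j 0| - `|x i 0|).
  rewrite sqrrB !real_normK ?num_real // => h; lra.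
have := ler_wpM2l (normr_ge0 (A j i)) h; lra.
Qed.

(* [0 <= qform B (B x - c x)], and the cubic term is at most [c |B x|^2]. *)
Lemma qform1_mul_le B c x : B^T = B -> (forall y, 0 <= qform B y) ->
  (forall y, qform B y <= c * qform 1%:M y) -> 0 < c ->
  qform 1%:M (B *m x) <= c * qform B x.
Proof.
move=> symB B0 Bc c0.
have := B0 ((B - c%:M) *m x).
rewrite qform_mul [(_ - _)^T]linearB /= symB tr_scalar_mx mulmxBr mul_mx_scalar.
rewrite !mulmxBl mul_scalar_mx scalerBr -scalemxAl.
have := Bc (B *m x).
rewrite !qform_mul symB mulmx1 !(qformB, qformZ).
set b3 := qform _ x; set b2 := qform (_ *m _) x; set b1 := qform _ x => h1 h2.
have h : c * b2 <= c * (c * b1) by lra.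
by rewrite -(ler_pM2l c0).
Qed.

(* Expand [0 <= |A y - a y|^2] at [y = invmx A *m x]. *)
Lemma qform_invmx_le A a x : A^T = A -> A \in unitmx -> 0 < a ->
  (forall y, a * qform 1%:M y <= qform A y) ->
  qform (invmx A) x <= a^-1 * qform 1%:M x.
Proof.
move=> symA uA a0 Aa.
have [y ->] : exists y, x = A *m y by exists (invmx A *m x); rewrite mulKVmx.
rewrite [a^-1 * _]mulrC ler_pdivlMr //.
have := qform1_ge0 ((A - a%:M) *m y); have := ler_wpM2l (ltW a0) (Aa y).
rewrite !qform_mul [(_ - _)^T]linearB /= symA tr_scalar_mx mulmx1 mulmxV // mul1mx.
rewrite !mulmxBl mulmx1 !mulmxBr !mul_scalar_mx !mul_mx_scalar scale_scalar_mx.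
by rewrite !qformB !qformZ (qform_scalar (a * a)); lra.
Qed.

Lemma posdef_trmx A : posdef A -> A^T = A.
Proof. by case. Qed.

Lemma posdef_ge0 A x : posdef A -> 0 <= qform A x.
Proof.
case=> _ pA; have [->|/pA /ltW //] := eqVneq x 0.
by rewrite qform0.
Qed.

Lemma unitmxP A : (forall x, A *m x = 0 -> x = 0) -> A \in unitmx.
Proof.
move=> inj; rewrite -unitmx_tr -row_free_unit -kermx_eq0.
apply/eqP/row_matrixP => i; rewrite row0; apply/trmx_inj; rewrite trmx0; apply: inj.
by rewrite -[A in A *m _]trmxK -trmx_mul -row_mul mulmx_ker row0 trmx0.
Qed.

Lemma posdef_unitmx A : posdef A -> A \in unitmx.
Proof.
case=> _ pA; apply: unitmxP => x Ax.
apply/eqP; apply: contraT => /pA.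
by rewrite /qform -mulmxA Ax mulmx0 mxE ltxx.
Qed.

(** Stands in for compactness of the unit sphere: if [e] bounds the squared norm of [invmx B] and
    [c] bounds the form of [B], then [|x|^2 <= e |B x|^2 <= e c x^T B x]. *)
Lemma psd_unitmx_coercive B : B^T = B -> (forall y, 0 <= qform B y) ->
  B \in unitmx -> exists2 d, 0 < d & forall x, d * qform 1%:M x <= qform B x.
Proof.
move=> symB B0 uB.
have [c c0 Bc] := qform_bounded B.
have [e e0 he] := qform_bounded ((invmx B)^T *m 1%:M *m invmx B).
exists (e * c)^-1; first by rewrite invr_gt0 mulr_gt0.
move=> x; rewrite mulrC ler_pdivrMr ?mulr_gt0 // mulrC -mulrA.
have := he (B *m x); rewrite -qform_mul mulKmx // => /le_trans; apply.
by rewrite ler_pM2l // qform1_mul_le.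
Qed.

Lemma psd_unitmx_posdef B : B^T = B -> (forall y, 0 <= qform B y) ->
  B \in unitmx -> posdef B.
Proof.
move=> symB B0 uB; split=> // x x0.
have [d d0 /(_ x)] := psd_unitmx_coercive symB B0 uB.
by apply: lt_le_trans; rewrite mulr_gt0 // qform1_gt0.
Qed.

Lemma posdef_invmx A : posdef A -> posdef (invmx A).
Proof.
move=> pA; have [symA A0] := pA; have uA := posdef_unitmx pA.
split=> [|x x0]; first by rewrite /Defs.symmetric trmx_inv symA.
have -> : x = A *m (invmx A *m x) by rewrite mulKVmx.
rewrite qform_mul symA mulmxV // mul1mx; apply: A0.
by apply: contra x0 => /eqP e; rewrite -[x](mulKVmx uA) e mulmx0.
Qed.

End QuadraticForms.

Section Congruence.
Variables (R : realType) (p n : nat).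

Lemma posdef_congr (A : 'M[R]_p) (C : 'M[R]_(p, n)) : posdef A ->
  (forall x : 'cV[R]_n, C *m x = 0 -> x = 0) -> posdef (C^T *m A *m C).
Proof.
case=> symA A0 injC; split=> [|x x0].
  by rewrite /Defs.symmetric !trmx_mul trmxK symA mulmxA.
rewrite -qform_mul; apply: A0; apply: contra x0 => /eqP /injC ->.
exact: eqxx.
Qed.

End Congruence.

(** * Extreme eigenvalues of symmetric matrices through the Rayleigh quotient *)

Section Rayleigh.
Local Open Scope classical_set_scope.
Variables (R : realType) (n : nat).
Implicit Types (A B : 'M[R]_n) (x : 'cV[R]_n).

(** [eigenvalue] speaks of row vectors; symmetry allows passing to columns by transposition. *)
Lemma eigenvalue_symP A a : A^T = A ->
  reflect (exists2 x : 'cV_n, A *m x = a *: x & x != 0) (eigenvalue A a).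
Proof.
move=> symA; apply: (iffP eigenvalueP) => -[v e v0]; exists v^T.
- by rewrite -[A]symA -trmx_mul e linearZ.
- by rewrite trmx_eq0.
- by rewrite -[A]symA -trmx_mul e linearZ.
- by rewrite trmx_eq0.
Qed.

Lemma qform_eigenvector A a x : A *m x = a *: x -> qform A x = a * qform 1%:M x.
Proof. by move=> e; rewrite /qform -mulmxA e -scalemxAr mxE mulmx1. Qed.

(* The supremum [s] of the Rayleigh quotient is an eigenvalue: otherwise the
   psd matrix [s - A] would be invertible, hence coercive. *)
Lemma rayleigh_sup A : (0 < n)%N -> A^T = A ->
  exists2 s, eigenvalue A s & forall x, qform A x <= s * qform 1%:M x.
Proof.
move=> n0 symA.
pose E : set R := [set r | exists2 x, x != 0 & r = qform A x / qform 1%:M x].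
have E0 : E !=set0.
  pose o : 'cV[R]_n := const_mx 1.
  exists (qform A o / qform 1%:M o); exists o => //.
  apply/eqP => /matrixP /(_ (Ordinal n0) 0); rewrite !mxE => /eqP.
  by rewrite oner_eq0.
have Eb : has_ubound E.
  have [c c0 Ac] := qform_bounded A.
  by exists c => _ [x x0 ->]; rewrite ler_pdivrMr ?qform1_gt0.
have As x : qform A x <= sup E * qform 1%:M x.
  have [->|x0] := eqVneq x 0; first by rewrite !qform0 mulr0.
  rewrite -ler_pdivrMr ?qform1_gt0 //; apply: ub_le_sup => //.
  by exists x.
exists (sup E) => //; apply: contraT => nE.
pose B := (sup E)%:M - A.
have symB : B^T = B by rewrite linearB /= tr_scalar_mx symA.
have BE x : qform B x = sup E * qform 1%:M x - qform A x.
  by rewrite qformB qform_scalar.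
have B0 x : 0 <= qform B x by rewrite BE subr_ge0.
have uB : B \in unitmx.
  apply: unitmxP => x /eqP; rewrite mulmxBl mul_scalar_mx subr_eq0 => /eqP e.
  apply/eqP; apply: contraT => x0; case/negP: nE.
  by apply/(eigenvalue_symP _ symA); exists x.
have [d d0 Bd] := psd_unitmx_coercive symB B0 uB.
(* Coercivity of [B] makes [sup E - d] an upper bound of [E] as well. *)
have : sup E <= sup E - d.
  apply: ge_sup => // _ [x x0 ->]; rewrite ler_pdivrMr ?qform1_gt0 // mulrBl.
  by have := Bd x; rewrite BE; lra.
by rewrite -[leLHS]addr0 lerD2l oppr_ge0 leNgt d0.
Qed.

Lemma lambda_maxP A : (0 < n)%N -> A^T = A ->
  eigenvalue A (lambda_max A) /\
  forall x, qform A x <= lambda_max A * qform 1%:M x.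
Proof.
move=> n0 symA; have [s es sub] := rayleigh_sup n0 symA.
suff -> : lambda_max A = s by [].
have ub : ubound [set a | eigenvalue A a] s.
  move=> a /(eigenvalue_symP _ symA) [x /qform_eigenvector e x0].
  by rewrite -(ler_pM2r (qform1_gt0 x0)) -e.
apply/le_anti/andP; split; first by apply: ge_sup => //; exists s.
by apply: ub_le_sup => //; exists s.
Qed.

Lemma lambda_minN A : lambda_min A = - lambda_max (- A).
Proof.
rewrite /lambda_min /lambda_max /inf; congr (- sup _).
have evN (B : 'M[R]_n) a : eigenvalue B a -> eigenvalue (- B) (- a).
  move=> /eigenvalueP[v e v0]; apply/eigenvalueP; exists v => //.
  by rewrite mulmxN e scaleNr.
apply/seteqP; split=> [_ [a /= /evN ea <-] //|a /= /evN].
by rewrite opprK => ea; exists (- a); rewrite ?opprK.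
Qed.

Lemma lambda_minP A : (0 < n)%N -> A^T = A ->
  eigenvalue A (lambda_min A) /\
  forall x, lambda_min A * qform 1%:M x <= qform A x.
Proof.
move=> n0 symA; have symN : (- A)^T = - A by rewrite linearN /= symA.
have [/(eigenvalue_symP _ symN)[v e v0] ub] := lambda_maxP n0 symN.
rewrite lambda_minN; split.
  apply/eigenvalue_symP => //; exists v => //.
  by rewrite scaleNr -e mulNmx opprK.
by move=> x; have := ub x; rewrite qformN mulNr lerNl.
Qed.

Lemma lambda_max_le A c : (0 < n)%N -> A^T = A ->
  (forall x, qform A x <= c * qform 1%:M x) -> lambda_max A <= c.
Proof.
move=> n0 symA Ac; have [+ _] := lambda_maxP n0 symA.
move=> /(eigenvalue_symP _ symA) [x /qform_eigenvector e x0].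
by rewrite -(ler_pM2r (qform1_gt0 x0)) -e.
Qed.

Lemma posdef_lambda_min_gt0 A : (0 < n)%N -> posdef A -> 0 < lambda_min A.
Proof.
move=> n0 [symA A0]; have [+ _] := lambda_minP n0 symA.
move=> /(eigenvalue_symP _ symA) [x /qform_eigenvector e x0].
by rewrite -(pmulr_lgt0 _ (qform1_gt0 x0)) -e A0.
Qed.

Lemma posdef_lambda_max_gt0 A : (0 < n)%N -> posdef A -> 0 < lambda_max A.
Proof.
move=> n0 [symA A0]; have [+ _] := lambda_maxP n0 symA.
move=> /(eigenvalue_symP _ symA) [x /qform_eigenvector e x0].
by rewrite -(pmulr_lgt0 _ (qform1_gt0 x0)) -e A0.
Qed.

End Rayleigh.

(** * Square roots and commutation in a given eigenbasis *)

Section SquareRoot.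
Variables (R : realType) (n : nat).
Implicit Types (A B C V : 'M[R]_n) (d e : 'rV[R]_n).

(** The eigenbasis formed by the columns of [V] is not assumed orthonormal, hence [invmx V] rather
    than [V^T]. *)
Definition eigen_mx V d : 'M[R]_n := V *m diag_mx d *m invmx V.

Lemma eigen_mxM V d e : V \in unitmx ->
  eigen_mx V d *m eigen_mx V e = eigen_mx V (\row_j (d 0 j * e 0 j)).
Proof.
by move=> uV; rewrite /eigen_mx !mulmxA mulmxKV // -[V *m _ *m _]mulmxA mulmx_diag.
Qed.

Lemma eigen_mx_comm V d e : V \in unitmx ->
  eigen_mx V d *m eigen_mx V e = eigen_mx V e *m eigen_mx V d.
Proof.
move=> uV; rewrite !eigen_mxM //; congr eigen_mx.
by apply/rowP => j; rewrite !mxE mulrC.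
Qed.

(** Entrywise, commuting says [C i j * (d j - d i) = 0]: a nonzero entry forces [d i = d j], hence
    equal values of [f]. *)
Lemma comm_diag_map (f : R -> R) d C :
  C *m diag_mx d = diag_mx d *m C ->
  C *m diag_mx (map_mx f d) = diag_mx (map_mx f d) *m C.
Proof.
rewrite !mul_mx_diag !mul_diag_mx => /matrixP e; apply/matrixP => i j.
have := e i j; rewrite !mxE [LHS]mulrC => eij.
have [c0|c0] := eqVneq (C i j) 0; first by rewrite c0 mulr0 mul0r.
by rewrite (mulIf c0 eij) mulrC.
Qed.

Lemma comm_eigen_mx_map (f : R -> R) V d C : V \in unitmx ->
  C *m eigen_mx V d = eigen_mx V d *m C ->
  C *m eigen_mx V (map_mx f d) = eigen_mx V (map_mx f d) *m C.
Proof.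
move=> uV e; pose X := invmx V *m C *m V.
have /(comm_diag_map f) eX : X *m diag_mx d = diag_mx d *m X.
  have := congr1 (fun Y => invmx V *m Y *m V) e.
  by rewrite /eigen_mx /X !mulmxA !mulmxKV // mulVmx // mul1mx.
have := congr1 (fun Y => V *m Y *m invmx V) eX.
by rewrite /eigen_mx /X !mulmxA mulmxV // mul1mx mulmxK.
Qed.

(** Symmetry of [eigen_mx V d] says that the Gram matrix [V^T *m V] commutes with [diag_mx d]; it
    then also commutes with the image of this diagonal under [f]. *)
Lemma eigen_mx_map_sym (f : R -> R) V d : V \in unitmx ->
  (eigen_mx V d)^T = eigen_mx V d ->
  (eigen_mx V (map_mx f d))^T = eigen_mx V (map_mx f d).
Proof.
move=> uV e; have uVT : V^T \in unitmx by rewrite unitmx_tr.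
have /(comm_diag_map f) : V^T *m V *m diag_mx d = diag_mx d *m (V^T *m V).
  have := congr1 (fun Y => V^T *m Y *m V) e.
  rewrite /eigen_mx !trmx_mul tr_diag_mx trmx_inv !mulmxA mulmxV // mul1mx.
  by rewrite mulmxKV // mulmxA.
move=> /(congr1 (fun Y => invmx V^T *m Y *m invmx V)).
rewrite /eigen_mx !trmx_mul tr_diag_mx trmx_inv !mulmxA mulVmx // mul1mx mulmxK //.
Qed.

Lemma eigen_mx_col V d j : V \in unitmx ->
  eigen_mx V d *m col j V = d 0 j *: col j V.
Proof.
move=> uV; rewrite colE /eigen_mx !mulmxA mulmxKV // -mulmxA.
by rewrite mul_diag_mx scalemxAr; congr (_ *m _); apply/matrixP => i k;
  rewrite !mxE; case: eqP => [->|] //; rewrite /= !mulr0.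
Qed.

Lemma col_unitmx_neq0 V j : V \in unitmx -> col j V != 0.
Proof.
move=> uV; rewrite colE; apply/eqP => /(congr1 (mulmx (invmx V))).
rewrite mulKmx // mulmx0 => /matrixP /(_ j 0); rewrite !mxE !eqxx => /eqP.
by rewrite oner_eq0.
Qed.

Lemma posdef_eigen_mx_gt0 V d j : V \in unitmx -> posdef (eigen_mx V d) -> 0 < d 0 j.
Proof.
move=> uV [_ /(_ _ (col_unitmx_neq0 j uV))].
rewrite (qform_eigenvector (eigen_mx_col d j uV)) pmulr_lgt0 //.
exact/qform1_gt0/col_unitmx_neq0.
Qed.

(* A square of an invertible symmetric matrix is positive definite, so the square
   root is obtained as the square of the fourth root. *)
Lemma eigen_mx_sqrt V d : V \in unitmx -> posdef (eigen_mx V d) ->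
  let B := eigen_mx V (map_mx Num.sqrt d) in posdef B /\ B *m B = eigen_mx V d.
Proof.
move=> uV pA B; have [symA _] := pA.
have d0 j : 0 < d 0 j by exact: posdef_eigen_mx_gt0 pA.
have BB : B *m B = eigen_mx V d.
  rewrite eigen_mxM //; congr eigen_mx; apply/rowP => j.
  by rewrite !mxE -expr2 sqr_sqrtr // ltW.
split=> //; pose C := eigen_mx V (map_mx (Num.sqrt \o Num.sqrt) d).
have symC : C^T = C by exact: eigen_mx_map_sym.
have CC : C *m C = B.
  rewrite eigen_mxM //; congr eigen_mx; apply/rowP => j.
  by rewrite !mxE -expr2 sqr_sqrtr // sqrtr_ge0.
have -> : B = C^T *m 1%:M *m C by rewrite symC mulmx1.
apply: posdef_congr => [|x Cx].
  by split=> [|x]; [exact: tr_scalar_mx | exact: qform1_gt0].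
apply/eqP; apply: contraT => /pA.2.
have Bx : B *m x = 0 by rewrite -CC -mulmxA Cx mulmx0.
have Ax : eigen_mx V d *m x = 0 by rewrite -BB -mulmxA Bx mulmx0.
by rewrite /qform -mulmxA Ax mulmx0 mxE ltxx.
Qed.

(** [(B - C) *m (B + C) = 0] because the two commute, and [B + C] is positive definite, hence
    invertible. *)
Lemma posdef_sqrt_unique B C : posdef B -> posdef C ->
  B *m B = C *m C -> B *m C = C *m B -> B = C.
Proof.
move=> [symB B0] [symC C0] e cBC.
have uBC : B + C \in unitmx.
  apply: posdef_unitmx; split=> [|x x0]; last by rewrite qformD addr_gt0 ?B0 ?C0.
  by rewrite /Defs.symmetric linearD /= symB symC.
apply/eqP; rewrite -subr_eq0 -[B - C](mulmxK uBC) mulmxBl !mulmxDr e cBC.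
by rewrite [_ + C *m C]addrC subrr mul0mx.
Qed.

(** Any positive definite root [C] commutes with its own square, hence with the root computed in the
    basis [V], so uniqueness among commuting roots applies. *)
Lemma msqrt_eigen_mx V d : V \in unitmx -> posdef (eigen_mx V d) ->
  msqrt (eigen_mx V d) = eigen_mx V (map_mx Num.sqrt d).
Proof.
move=> uV pA; have [pB BB] := eigen_mx_sqrt uV pA.
apply: xget_unique => // C [pC CC]; apply: posdef_sqrt_unique => //.
  by rewrite CC BB.
by apply: comm_eigen_mx_map => //; rewrite -CC mulmxA.
Qed.

Lemma shared_eigenbasis A C :
  (exists V : 'M[R]_n, V \in unitmx /\
     forall j : 'I_n, exists a b : R,
       C *m col j V = a *: col j V /\ A *m col j V = b *: col j V) ->
  exists V d e, [/\ V \in unitmx, A = eigen_mx V d & C = eigen_mx V e].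
Proof.
case=> V [uV /fin_all_exists [a /fin_all_exists [b ab]]].
have diagE (D : 'M[R]_n) (c : 'I_n -> R) : (forall j, D *m col j V = c j *: col j V) ->
    D = eigen_mx V (\row_j c j).
  move=> h; rewrite -[LHS](mulmxK uV); congr (_ *m _).
  apply/matrixP => i j; rewrite mul_mx_diag.
  have /matrixP /(_ i 0) := h j; rewrite colE mulmxA -colE [LHS]mxE => ->.
  by rewrite -colE !mxE mulrC.
exists V, (\row_j b j), (\row_j a j); split=> //.
  by apply: diagE => j; have [] := ab j.
by apply: diagE => j; have [] := ab j.
Qed.

(** The shared eigenbasis serves twice: it diagonalizes [A], so that the root exists, and it makes
    the root commute with [C]. *)
Lemma msqrtP A C : posdef A ->
  (exists V : 'M[R]_n, V \in unitmx /\
     forall j : 'I_n, exists a b : R,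
       C *m col j V = a *: col j V /\ A *m col j V = b *: col j V) ->
  [/\ posdef (msqrt A), msqrt A *m msqrt A = A & msqrt A *m C = C *m msqrt A].
Proof.
move=> pA /shared_eigenbasis [V [d [e [uV eA ->]]]]; move: pA; rewrite {}eA => pA.
have [pB BB] := eigen_mx_sqrt uV pA.
by rewrite msqrt_eigen_mx //; split=> //; exact: eigen_mx_comm.
Qed.

End SquareRoot.

(** * The regularized projection [P] and the inequality [P^2 <= P] *)

Section RegularizedProjection.
Variables (R : realType) (p n : nat) (lam : R) (A : 'M[R]_(p, n)).

(* The Moore-Penrose inverse need not exist for this: its default value 0 also
   satisfies the conclusion. *)
Lemma reg_pinv_mulmx_contraction : 0 <= lam ->
  let P := reg_pinv lam A *m A in
  P^T = P /\ forall x : 'cV[R]_n, qform 1%:M (P *m x) <= qform P x.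
Proof.
rewrite le_eqVlt eq_sym /reg_pinv => /predU1P[->|lam0]; rewrite ?eqxx ?gt_eqF //=.
  (* At [lam = 0] the matrix is a symmetric idempotent, and equality holds. *)
  suff [symP PP] : (mp_pinv A *m A)^T = mp_pinv A *m A /\
      mp_pinv A *m A *m (mp_pinv A *m A) = mp_pinv A *m A.
    by split=> // x; rewrite qform_mul symP mulmx1 PP.
  rewrite /mp_pinv; case: xgetP => [X _ [_ XAX _ symXA]|_].
    by rewrite mulmxA XAX.
  by rewrite !mul0mx trmx0.
pose D := A^T *m A; rewrite -/D.
have symD : D^T = D by rewrite /D trmx_mul trmxK.
have DE x : qform D x = qform 1%:M (A *m x) by rewrite qform_mul mulmx1.
have symK : (D + lam%:M)^T = D + lam%:M by rewrite linearD /= symD tr_scalar_mx.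
have uK : D + lam%:M \in unitmx.
  apply: posdef_unitmx; split=> // x x0; rewrite qformD qform_scalar.
  by rewrite DE ltr_wpDl ?qform1_ge0 // mulr_gt0 // qform1_gt0.
set L := invmx _; have symL : L^T = L by rewrite trmx_inv symK.
have PE : L *m A^T *m A = 1%:M - lam *: L.
  rewrite -mulmxA -/D -[D](addrK lam%:M) mulmxBr mulVmx //.
  by rewrite mul_mx_scalar.
have symP : (L *m A^T *m A)^T = L *m A^T *m A.
  by rewrite PE linearB linearZ /= trmx1 symL.
split=> // x.
(* With [P = 1 - lam L], one gets [P^2 = P - lam L D L], where [L D L] is positive semidefinite. *)
have PP : L *m A^T *m A *m (L *m A^T *m A) = L *m A^T *m A - lam *: (L *m D *m L).
  by rewrite {2}PE mulmxBr mulmx1 -scalemxAr -[L *m A^T *m A]mulmxA.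
rewrite qform_mul symP mulmx1 PP qformB qformZ gerBl.
rewrite mulr_ge0 ?(ltW lam0) // -[L in L *m D]symL -qform_mul.
by rewrite DE qform1_ge0.
Qed.

End RegularizedProjection.

Lemma PS_contraction (R : realType) m n (lam : R) (J : 'M[R]_(m, n)) S : 0 <= lam ->
  (PS lam J S)^T = PS lam J S /\
  forall x : 'cV[R]_n, qform 1%:M (PS lam J S *m x) <= qform (PS lam J S) x.
Proof. exact: reg_pinv_mulmx_contraction. Qed.

(** * Averages over [k]-subsets and over sequences of independent draws *)

Section SubsetAverage.
Variables (R : realType) (m k : nat).
Hypothesis km : (k <= m)%N.

Lemma card_ksubsets_gt0 : 0 < #|ksubsets m k|%:R :> R.
Proof. by rewrite ltr0n card_draws card_ord bin_gt0. Qed.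

Lemma ES_tr p q (F : {set 'I_m} -> 'M[R]_(p, q)) :
  (ES k F)^T = ES k (fun S => (F S)^T).
Proof. by rewrite /ES linearZ linear_sum. Qed.

Lemma ES_mul p q r s (C : 'M[R]_(p, q)) (F : {set 'I_m} -> 'M[R]_(q, r))
    (D : 'M[R]_(r, s)) :
  C *m ES k F *m D = ES k (fun S => C *m F S *m D).
Proof. by rewrite /ES -scalemxAr -scalemxAl mulmx_sumr mulmx_suml. Qed.

Lemma ES_cst p q (C : 'M[R]_(p, q)) : ES k (fun _ : {set 'I_m} => C) = C.
Proof.
rewrite /ES sumr_const -scaler_nat scalerA mulVf ?scale1r //.
by rewrite gt_eqF // card_ksubsets_gt0.
Qed.

Lemma ESD p q (F G : {set 'I_m} -> 'M[R]_(p, q)) :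
  ES k (fun S => F S + G S) = ES k F + ES k G.
Proof. by rewrite /ES big_split scalerDr. Qed.

Lemma ESZ p q a (F : {set 'I_m} -> 'M[R]_(p, q)) :
  ES k (fun S => a *: F S) = a *: ES k F.
Proof. by rewrite /ES -scaler_sumr !scalerA mulrC. Qed.

Lemma qform_ES n (F : {set 'I_m} -> 'M[R]_n) x :
  qform (ES k F) x = #|ksubsets m k|%:R^-1 * \sum_(S in ksubsets m k) qform (F S) x.
Proof. by rewrite /ES qformZ qform_sum. Qed.

Lemma ler_qform_ES n (F G : {set 'I_m} -> 'M[R]_n) x :
  (forall S, qform (F S) x <= qform (G S) x) ->
  qform (ES k F) x <= qform (ES k G) x.
Proof.
move=> FG; rewrite !qform_ES ler_pM2l ?invr_gt0 ?card_ksubsets_gt0 //.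
by apply: ler_sum => S _; exact: FG.
Qed.

Lemma qform_ES_ge0 n (F : {set 'I_m} -> 'M[R]_n) x :
  (forall S, 0 <= qform (F S) x) -> 0 <= qform (ES k F) x.
Proof.
move=> F0; rewrite qform_ES mulr_ge0 ?invr_ge0 ?ler0n //.
by apply: sumr_ge0 => S _; exact: F0.
Qed.

Lemma qform_ES_eq0 n (F : {set 'I_m} -> 'M[R]_n) x :
  (forall S, 0 <= qform (F S) x) -> qform (ES k F) x = 0 ->
  forall S, S \in ksubsets m k -> qform (F S) x = 0.
Proof.
move=> F0 /eqP; rewrite qform_ES mulf_eq0 invr_eq0 gt_eqF ?card_ksubsets_gt0 //=.
by move=> /eqP + S Sk => /psumr_eq0P; apply.
Qed.

Definition ffun_cons (T : Type) t (a : T) (s : {ffun 'I_t -> T}) : {ffun 'I_t.+1 -> T} :=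
  [ffun i => oapp s a (unlift ord0 i)].

Lemma fgraph_ffun_cons (T : Type) t (a : T) (s : {ffun 'I_t -> T}) :
  fgraph (ffun_cons a s) = a :: fgraph s :> seq T.
Proof.
rewrite !fgraph_codom /= /codom /image_mem enum_ordSl /= ffunE unlift_none /=.
rewrite -map_comp; congr cons; apply: eq_map => i /=.
by rewrite ffunE liftK.
Qed.

(** Conditioning on the first draw: sequences of length [t.+1] are in bijection with pairs of a head
    and a tail. *)
Lemma Eiter_recl t (F : {ffun 'I_t.+1 -> {set 'I_m}} -> R) :
  Eiter k F = #|ksubsets m k|%:R^-1 *
    \sum_(S in ksubsets m k) Eiter k (fun s => F (ffun_cons S s)).
Proof.
rewrite /Eiter -mulr_sumr mulrA -invfM -exprS; congr (_ * _).
rewrite pair_big /=.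
pose split_ffun (s : {ffun 'I_t.+1 -> {set 'I_m}}) :=
  (s ord0, [ffun i => s (lift ord0 i)] : {ffun 'I_t -> {set 'I_m}}).
have splitK : cancel split_ffun (fun u => ffun_cons u.1 u.2).
  move=> s; apply/ffunP => i; rewrite ffunE.
  by case: unliftP => [j ->|->] //=; rewrite ffunE.
have consK : cancel (fun u => ffun_cons u.1 u.2) split_ffun.
  move=> [S s]; congr pair; first by rewrite ffunE unlift_none.
  by apply/ffunP => i; rewrite !ffunE liftK.
rewrite (reindex (fun u => ffun_cons u.1 u.2)) /=; last first.
  by exists split_ffun => ? _; [exact: consK | exact: splitK].
apply: eq_bigl => -[S s] /=; apply/forallP/andP => [h|[hS /forallP hs] i].
  split; first by have := h ord0; rewrite ffunE unlift_none.
  by apply/forallP => i; have := h (lift ord0 i); rewrite ffunE liftK.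
by rewrite ffunE; case: unliftP => [j _|_] //=; exact: hs.
Qed.

(** Induction on [t]: the remaining draws restart the iteration from the point that the first draw
    produced, so the bound is proved for every [th0]. The sign of [rho] allows multiplying the
    one-step bound by [rho ^+ t]. *)
Lemma Eiter_contraction n (lam eta rho : R) (J : 'M[R]_(m, n)) H q
    (f : 'cV[R]_n -> R) :
  0 <= rho ->
  (forall th, #|ksubsets m k|%:R^-1 *
     \sum_(S in ksubsets m k) f (sngd_step lam eta J H q S th) <= rho * f th) ->
  forall t th0, Eiter k (fun s : {ffun 'I_t -> {set 'I_m}} =>
    f (sngd_iter lam eta J H q th0 s)) <= rho ^+ t * f th0.
Proof.
move=> rho0 step; elim=> [|t IHt] th0.
  rewrite /Eiter !expr0 invr1 !mul1r (big_pred1 [ffun=> finset.set0]) => [|s].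
    by rewrite /sngd_iter fgraph_codom /= /codom /image_mem enum_ord0.
  have -> : s = [ffun=> finset.set0] by apply/ffunP => -[].
  by rewrite /= eqxx; apply/forallP => -[].
rewrite Eiter_recl exprSr -mulrA.
apply: le_trans (ler_wpM2l (exprn_ge0 t rho0) (step th0)).
rewrite mulrCA ler_pM2l ?invr_gt0 ?card_ksubsets_gt0 // mulr_sumr.
apply: ler_sum => S _; apply: le_trans (IHt _).
rewrite le_eqVlt; apply/orP; left; apply/eqP; congr (_ * _).
by apply: eq_bigr => s _; rewrite /sngd_iter fgraph_ffun_cons.
Qed.

End SubsetAverage.

(** Completing the square replaces differentiation: with [v1 = - (invmx H *m q)], the excess of the
    loss at [v] over [v1] is half of [qform H (v - v1)]. *)
Lemma quadL_argmin (R : realType) m (H : 'M[R]_m) q c v0 : posdef H ->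
  (forall v, quadL H q c v0 <= quadL H q c v) -> H *m v0 = - q.
Proof.
move=> pH v0_min; have [symH H0] := pH; have uH := posdef_unitmx pH.
pose v1 := - (invmx H *m q); have Hv1 : H *m v1 = - q by rewrite mulmxN mulKVmx.
suff -> : v0 = v1 by [].
apply/eqP; rewrite -subr_eq0; apply: contraT => /H0; have := v0_min v1.
have qE v : (v^T *m q) 0 0 = - (v^T *m H *m v1) 0 0.
  by rewrite -mulmxA Hv1 mulmxN [in RHS]mxE opprK.
have cross : (v1^T *m H *m v0) 0 0 = (v0^T *m H *m v1) 0 0.
  have -> : v1^T *m H *m v0 = (v0^T *m H *m v1)^T.
    by rewrite !trmx_mul trmxK symH mulmxA.
  by rewrite mxE.
have entryB (X Y : 'M[R]_1) : (X - Y) 0 0 = X 0 0 - Y 0 0 by rewrite !mxE.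
rewrite /quadL !qE /qform [(_ - _)^T]linearB /= !(mulmxBl, mulmxBr) !entryB cross.
lra.
Qed.

(** The scalar core. The step size makes the second-order term at most [eta * h], which costs half
    of the gain [2 * eta * h]; the other half is at least [eta * mH * a * qe]. *)
Lemma descent_bound (R : realFieldType) (lN lH mH a qe r h qN : R) :
  0 < lN -> 0 < lH -> 0 < mH ->
  qN <= lN * (lH * h) -> a * qe <= r -> mH * r <= h ->
  qe - 2 * (1 / lN / lH) * h + (1 / lN / lH) ^+ 2 * qN <=
  (1 - 1 / (lH / mH) * a * (1 / lN)) * qe.
Proof.
move=> lN0 lH0 mH0 hN ha hh; set eta := 1 / lN / lH.
have eta0 : 0 < eta by rewrite !divr_gt0.
have hN' : eta ^+ 2 * qN <= eta * h.
  have -> : eta * h = eta ^+ 2 * (lN * (lH * h)).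
    by rewrite /eta; field; rewrite !gt_eqF.
  by rewrite ler_wpM2l // sqr_ge0.
have hmu : eta * (mH * (a * qe)) <= eta * h.
  by rewrite ler_pM2l // (le_trans _ hh) // ler_pM2l.
have -> : 1 / (lH / mH) * a * (1 / lN) = eta * mH * a.
  by rewrite /eta; field; rewrite !gt_eqF.
lra.
Qed.

(** * One-step mean contraction for abstract [P S]; [B] stands for the root of [J^T J] and [K] for
    [J^T H J] *)

Section PreconditionedDescent.
Variables (R : realType) (m n k : nat) (P : {set 'I_m} -> 'M[R]_n) (B K : 'M[R]_n).
Hypotheses (km : (k <= m)%N) (n0 : (0 < n)%N).
Hypothesis symP : forall S, (P S)^T = P S.
Hypothesis contrP : forall S x, qform 1%:M (P S *m x) <= qform (P S) x.
Hypothesis posB : posdef B.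
Hypothesis posK : posdef K.

Let Pbar := ES k P.
Let M := invmx B.
Let Q := M *m Pbar *m M.
Let Ht := M *m K *m M.
Let N := ES k (fun S => M *m P S *m invmx Q *m P S *m M).
Let gamma := 1 / lambda_max N.
Let eta := gamma / lambda_max Ht.

Hypothesis unitPbar : Pbar \in unitmx.
Hypothesis commB : B *m Pbar = Pbar *m B.

Let uB : B \in unitmx. Proof. exact: posdef_unitmx. Qed.

Let symB : B^T = B. Proof. exact: posdef_trmx. Qed.

Let symM : M^T = M. Proof. by rewrite trmx_inv symB. Qed.

Let injM (x : 'cV[R]_n) : M *m x = 0 -> x = 0.
Proof. by move=> e; rewrite -[x](mulKVmx uB) -/M e mulmx0. Qed.

Let posM_congr (A : 'M[R]_n) : posdef A -> posdef (M *m A *m M).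
Proof. by move=> pA; rewrite -{1}symM; exact: posdef_congr. Qed.

Let P_ge0 S x : 0 <= qform (P S) x.
Proof. exact: le_trans (qform1_ge0 _) (contrP S x). Qed.

Let symPbar : Pbar^T = Pbar.
Proof. by rewrite ES_tr; congr ES; apply/funext => S; rewrite symP. Qed.

Let posPbar : posdef Pbar.
Proof. by apply: psd_unitmx_posdef => // x; apply: qform_ES_ge0. Qed.

Let posQ : posdef Q. Proof. exact: posM_congr. Qed.

Let posHt : posdef Ht. Proof. exact: posM_congr. Qed.

Let uQ : Q \in unitmx. Proof. exact: posdef_unitmx. Qed.

Let invQ : invmx Q = B *m invmx Pbar *m B.
Proof.
apply: (can_inj (mulKmx uQ)); rewrite mulmxV // /Q /M.
by rewrite !mulmxA mulmxKV // mulmxK // mulVmx.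
Qed.

Let symQ' : (invmx Q)^T = invmx Q.
Proof. exact: posdef_trmx (posdef_invmx posQ). Qed.

Let symMPM S : (P S *m M)^T = M *m P S.
Proof. by rewrite trmx_mul symM symP. Qed.

Let N_termE S x :
  qform (M *m P S *m invmx Q *m P S *m M) x = qform (invmx Q) (P S *m M *m x).
Proof. by rewrite qform_mul symMPM !mulmxA. Qed.

Let symN : N^T = N.
Proof.
rewrite ES_tr; congr ES; apply/funext => S.
by rewrite !trmx_mul symM symP symQ' !mulmxA.
Qed.

(** If the form of [N] vanishes at [x], then every [P S *m M *m x] with [S] a [k]-subset is 0, hence
    so is [Pbar *m M *m x], and [Pbar] and [M] are injective. This makes [gamma] a genuine positive
    reciprocal. *)
Let posN : posdef N.
Proof.
split=> // x x0; rewrite lt_neqAle qform_ES_ge0 => [|S]; last first.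
  by rewrite N_termE posdef_ge0 //; exact: posdef_invmx.
rewrite andbT eq_sym; apply: contra x0 => /eqP /qform_ES_eq0 h.
have Px S : S \in ksubsets m k -> P S *m M *m x = 0.
  move=> /h h0; apply/eqP; apply: contraT => /(posdef_invmx posQ).2.
  by rewrite -N_termE h0 ?ltxx // => T; rewrite N_termE posdef_ge0 //; exact: posdef_invmx.
have PMx : Pbar *m (M *m x) = 0.
  rewrite /Pbar /ES -scalemxAl mulmx_suml big1 ?scaler0 // => S /Px.
  by rewrite mulmxA.
by apply/eqP/injM; rewrite -[M *m x](mulKmx unitPbar) PMx mulmx0.
Qed.

Lemma inv_cond_number_le_gamma : 1 / cond_number Q <= gamma.
Proof.
have lmin := posdef_lambda_min_gt0 n0 posQ.
have lmax := posdef_lambda_max_gt0 n0 posQ.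
rewrite /gamma /cond_number !div1r lef_pV2 ?posrE ?divr_gt0 ?posdef_lambda_max_gt0 //.
apply: lambda_max_le => // x.
have [_ Qmax] := lambda_maxP n0 (posdef_trmx posQ).
have [_ Qmin] := lambda_minP n0 (posdef_trmx posQ).
(* The intermediate matrix [Q / lambda_min Q] dominates [N] term by term and is itself at most
   [cond_number Q]. *)
apply: (@le_trans _ _ (qform ((lambda_min Q)^-1 *: Q) x)); last first.
  by rewrite qformZ mulrAC [leRHS]mulrC; apply: ler_wpM2l (Qmax x); rewrite invr_ge0 ltW.
have -> : (lambda_min Q)^-1 *: Q = ES k (fun S => (lambda_min Q)^-1 *: (M *m P S *m M)).
  by rewrite ESZ -ES_mul.
apply: ler_qform_ES => // S; rewrite N_termE qformZ.
apply: (le_trans (qform_invmx_le _ _ uQ lmin Qmin)); first exact: posdef_trmx.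
rewrite ler_pM2l ?invr_gt0 // -mulmxA -[M in M *m P S]symM -qform_mul.
exact: contrP.
Qed.

(** In the application this is [(J^T J)^-1 J^T H J], the least-squares solution of [J W = H J]. *)
Let W := M *m M *m K.

Let WE : W = M *m Ht *m B.
Proof. by rewrite /W /Ht !mulmxA mulmxKV. Qed.

Let KE : K = B *m Ht *m B.
Proof. by rewrite /Ht !mulmxA mulmxV // mul1mx mulmxKV. Qed.

Let symHt : Ht^T = Ht. Proof. exact: posdef_trmx. Qed.

Let WT : W^T = B *m Ht *m M.
Proof. by rewrite WE trmx_mul symB trmx_mul symM symHt mulmxA. Qed.

(* The cross term: [invmx Q *m Pbar = B *m B] because [B] and [Pbar] commute. *)
Let cross_term : invmx Q *m Pbar *m W = K.
Proof.
rewrite invQ -!mulmxA (mulmxA B Pbar) commB -!mulmxA mulKmx // /W.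
by rewrite !mulmxA mulmxK // mulmxV // mul1mx.
Qed.

Lemma mean_sqr_step e : let u := B *m e in
  #|ksubsets m k|%:R^-1 * (\sum_(S in ksubsets m k)
     qform (invmx Q) (e - eta *: (P S *m (W *m e))))
  = qform (invmx Q) e - 2 * eta * qform Ht u + eta ^+ 2 * qform N (Ht *m u).
Proof.
move=> u; pose T S := 1%:M - eta *: (P S *m W).
rewrite (eq_bigr (fun S => qform ((T S)^T *m invmx Q *m T S) e)); last first.
  by move=> S _; rewrite -qform_mul mulmxBl mul1mx -scalemxAl mulmxA.
rewrite -qform_ES.
(* Both cross terms average to [K], the second one by transposition. *)
have K1 : ES k (fun S => invmx Q *m P S *m W) = K by rewrite -ES_mul cross_term.
have K2 : ES k (fun S => W^T *m P S *m invmx Q) = K.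
  rewrite -(posdef_trmx posK) -[in RHS]K1 ES_tr; congr ES; apply/funext => S.
  by rewrite [RHS]trmx_mul [X in _ = _ *m X]trmx_mul symP symQ' mulmxA.
(* The last term is written around the summand of [N], through [W = M *m Ht *m B], so that averaging
   produces [N]. *)
have TE S : (T S)^T *m invmx Q *m T S =
    invmx Q + ((- eta) *: (W^T *m P S *m invmx Q) + ((- eta) *: (invmx Q *m P S *m W) +
      eta ^+ 2 *: (B *m Ht *m (M *m P S *m invmx Q *m P S *m M) *m (Ht *m B)))).
  have TT : (T S)^T = 1%:M - eta *: (W^T *m P S).
    by rewrite [LHS]linearB linearZ /= trmx1 trmx_mul symP.
  have -> : B *m Ht *m (M *m P S *m invmx Q *m P S *m M) *m (Ht *m B) =
      W^T *m P S *m invmx Q *m (P S *m W) by rewrite WT WE !mulmxA.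
  rewrite TT /T mulmxBl mul1mx mulmxBr mulmx1 -!scalemxAl mulmxBl -!scalemxAr.
  rewrite -!scalemxAl scalerA -expr2 !scaleNr opprB -addrA.
  by congr (_ + (_ + _)); rewrite addrC !mulmxA.
have -> : ES k (fun S => (T S)^T *m invmx Q *m T S) =
    ES k (fun S => invmx Q + ((- eta) *: (W^T *m P S *m invmx Q) +
      ((- eta) *: (invmx Q *m P S *m W) +
       eta ^+ 2 *: (B *m Ht *m (M *m P S *m invmx Q *m P S *m M) *m (Ht *m B))))).
  by congr ES; apply/funext => S.
rewrite !ESD !ESZ ES_cst // K1 K2 -ES_mul.
have -> : qform Ht u = qform K e by rewrite qform_mul symB -KE.
have -> : qform N (Ht *m u) = qform (B *m Ht *m N *m (Ht *m B)) e.
  by rewrite mulmxA qform_mul trmx_mul symB symHt.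
rewrite !qformD !qformZ.
ring.
Qed.

Lemma preconditioned_descent e :
  #|ksubsets m k|%:R^-1 * (\sum_(S in ksubsets m k)
     qform (invmx Q) (e - eta *: (P S *m (W *m e))))
  <= (1 - (1 / cond_number Ht) * lambda_min Pbar * gamma) * qform (invmx Q) e.
Proof.
rewrite mean_sqr_step; set u := B *m e.
have lN := posdef_lambda_max_gt0 n0 posN.
have lH := posdef_lambda_max_gt0 n0 posHt.
have mH := posdef_lambda_min_gt0 n0 posHt.
have aP := posdef_lambda_min_gt0 n0 posPbar.
have [_ Nmax] := lambda_maxP n0 symN.
have [_ Hmax] := lambda_maxP n0 symHt.
have [_ /(_ u) Hmin] := lambda_minP n0 symHt.
have [_ Pmin] := lambda_minP n0 symPbar.
apply: (descent_bound lN lH mH (r := qform 1%:M u)) => //.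
- have Ht_ge0 y : 0 <= qform Ht y by exact: posdef_ge0.
  have hHt := qform1_mul_le u symHt Ht_ge0 Hmax lH.
  exact: le_trans (Nmax (Ht *m u)) (ler_wpM2l (ltW lN) hHt).
(* By [invQ] the squared error is the [invmx Pbar]-form of [u], which is at most
   [|u|^2 / lambda_min Pbar]. *)
- rewrite -ler_pdivlMl // invQ -{1}symB -qform_mul.
  exact: qform_invmx_le.
Qed.

(** At a nonzero vector the one-step bound has a nonnegative mean on the left and the rate times a
    positive number on the right. *)
Lemma descent_rate_ge0 : 0 <= 1 - (1 / cond_number Ht) * lambda_min Pbar * gamma.
Proof.
have e0 : (const_mx 1 : 'cV[R]_n) != 0.
  by apply/eqP => /matrixP /(_ (Ordinal n0) 0) /eqP; rewrite !mxE oner_eq0.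
rewrite -(pmulr_lge0 _ ((posdef_invmx posQ).2 _ e0)).
apply: le_trans (preconditioned_descent _); rewrite mulr_ge0 ?invr_ge0 //.
by apply: sumr_ge0 => S _; exact: posdef_ge0 (posdef_invmx posQ).
Qed.

End PreconditionedDescent.

(** * Reduction of SNGD to the abstract descent *)

Lemma rows_of_mul (R : realType) m p q (S : {set 'I_m}) (A : 'M[R]_(m, p)) (C : 'M[R]_(p, q)) :
  rows_of S A *m C = rows_of S (A *m C).
Proof. by rewrite /rows_of mul_rowsub_mx. Qed.

Lemma lambda_max_mx0 (R : realType) (A : 'M[R]_0) : lambda_max A = 0.
Proof.
rewrite /lambda_max (_ : mkset _ = classical_sets.set0) ?sup0 //.
by apply/seteqP; split=> // a /= /eigenvalueP[v _]; rewrite [v]thinmx0 eqxx.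
Qed.

Lemma mulmx_rank_inj (R : realType) m n (J : 'M[R]_(m, n)) (x : 'cV[R]_n) :
  \rank J = n -> J *m x = 0 -> x = 0.
Proof.
move=> rkJ /(congr1 trmx); rewrite trmx_mul trmx0 => /eqP.
rewrite mulmx_free_eq0 ?trmx_eq0 => [/eqP //|].
by rewrite /row_free mxrank_tr rkJ.
Qed.

(** By optimality the sampled residual consists of the rows [S] of
    [H J (th - thstar) = J W (th - thstar)], so [reg_pinv] meets [rows_of S J] and forms [PS]. *)
Lemma sngd_step_error (R : realType) m n (J : 'M[R]_(m, n)) H q lam eta
    (W : 'M[R]_n) (thstar th : 'cV[R]_n) (S : {set 'I_m}) :
  H *m (J *m thstar) = - q -> J *m W = H *m J ->
  sngd_step lam eta J H q S th - thstar =
  (th - thstar) - eta *: (PS lam J S *m (W *m (th - thstar))).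
Proof.
move=> opt JW; rewrite /sngd_step /PS addrAC; congr (_ - _ *: _).
rewrite -[RHS]mulmxA; congr (_ *m _).
rewrite [in RHS]rows_of_mul [in RHS]mulmxA JW mulmxBr -[H *m J *m thstar]mulmxA opt opprK.
rewrite -mulmxA !rows_of_mul mulmxA.
by apply/matrixP => i j; rewrite [LHS]mxE ![rows_of _ _ _ _]mxE [RHS]mxE.
Qed.

Theorem theorem2 (R : realType) (m n k : nat)
  (J : 'M[R]_(m, n)) (H : 'M[R]_m) (q : 'cV[R]_m) (c lam : R)
  (thstar : 'cV[R]_n) :
  \rank J = n ->
  posdef H ->
  (* strong consistency (1): J thstar minimizes the quadratic L *)
  (forall v : 'cV[R]_m, quadL H q c (J *m thstar) <= quadL H q c v) ->
  (* strong consistency (2): range(HJ) is contained in range(J) *)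
  (forall x : 'cV[R]_n, exists y : 'cV[R]_n, H *m J *m x = J *m y) ->
  (0 < k <= m)%N ->
  0 <= lam ->
  let Pbar := ES k (PS lam J) in
  let alpha := lambda_min Pbar in
  Pbar \in unitmx ->
  (* Pbar and J^T J share an eigenbasis *)
  (exists V : 'M[R]_n, V \in unitmx /\
     forall j : 'I_n, exists a b : R,
       Pbar *m col j V = a *: col j V /\ (J^T *m J) *m col j V = b *: col j V) ->
  let M := minvsqrt (J^T *m J) in
  let Qbar := M *m Pbar *m M in
  let Htil := M *m J^T *m H *m J *m M in
  let gamma := 1 / lambda_max (ES k (fun S => M *m PS lam J S *m invmx Qbar
                                               *m PS lam J S *m M)) in
  let eta := gamma / lambda_max Htil in
  gamma >= 1 / cond_number Qbar /\
  forall (th0 : 'cV[R]_n) (t : nat),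
    Eiter k (fun s : {ffun 'I_t -> {set 'I_m}} =>
       qform (invmx Qbar) (sngd_iter lam eta J H q th0 s - thstar))
    <= (1 - (1 / cond_number Htil) * alpha * gamma) ^+ t
       * qform (invmx Qbar) (th0 - thstar).
Proof.
move=> rkJ posH v0min rangeHJ /andP[_ km] lam0 Pbar alpha uPbar eigV M Qbar Htil gamma eta.
(* For [n = 0] there are no eigenvalues: [lambda_max] takes the default 0, both sides of the first
   claim become 0, and all quadratic forms vanish. *)
have [n_eq0|n0] := posnP n.
  subst n; split=> [|th0 t].
    by rewrite /gamma /cond_number !lambda_max_mx0 !mul0r invr0 mulr0.
  have q0 (A : 'M[R]_0) x : qform A x = 0 by rewrite [x]flatmx0 qform0.
  by rewrite q0 mulr0 /Eiter big1 ?mulr0.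
have injJ (x : 'cV[R]_n) : J *m x = 0 -> x = 0 by exact: mulmx_rank_inj.
have posG : posdef (J^T *m J).
  rewrite -[J in _ *m J]mul1mx mulmxA; apply: posdef_congr => //.
  by split=> [|x]; [exact: tr_scalar_mx | exact: qform1_gt0].
have posK : posdef (J^T *m H *m J) by exact: posdef_congr.
have [posB BB BP] := msqrtP posG eigV.
have uB := posdef_unitmx posB.
have HtilE : Htil = M *m (J^T *m H *m J) *m M by rewrite /Htil !mulmxA.
clearbody Htil; subst Htil.
have symP S := (PS_contraction J S lam0).1.
have contrP S := (PS_contraction J S lam0).2.
(* Column by column, [H J] has the form [J y] by the range inclusion, and [(J^T J)^-1 J^T] recovers
   [y] from [J y]. *)
have JW : J *m (M *m M *m (J^T *m H *m J)) = H *m J.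
  apply/trmx_inj/row_matrixP => i; rewrite -!tr_col !colE; congr trmx.
  have [y HJy] := rangeHJ (delta_mx i 0).
  rewrite HJy -!mulmxA [H *m (J *m _)]mulmxA HJy [J^T *m _]mulmxA -BB.
  by rewrite -mulmxA !mulKmx.
have opt := quadL_argmin posH v0min.
have descent := preconditioned_descent km n0 symP contrP posB posK uPbar BP.
have step th : #|ksubsets m k|%:R^-1 * (\sum_(S in ksubsets m k)
    qform (invmx Qbar) (sngd_step lam eta J H q S th - thstar)) <=
  (1 - 1 / cond_number (M *m (J^T *m H *m J) *m M) * alpha * gamma) *
    qform (invmx Qbar) (th - thstar).
  under eq_bigr => S _ do rewrite (sngd_step_error lam eta th S opt JW).
  exact: descent.
split; first exact: inv_cond_number_le_gamma.
have rate0 := descent_rate_ge0 km n0 symP contrP posB posK uPbar BP.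
move=> th0 t.
exact: (Eiter_contraction km (f := fun th => qform (invmx Qbar) (th - thstar)) rate0 step).
Qed.
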